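(* Let $f$ be a non-zero polynomial in one variable with complex coefficients, and for $n\in\mathbb{N}$ let $M_n(f)=\int_0^1 f(x)^n\,dx$. Then $$\limsup_{n\to\infty}|M_n(f)|^{1/n}>0.$$ In particular, $M_n(f)\neq 0$ for infinitely many $n\in\mathbb{N}$.
   Context: The integral is over the real interval $[0,1]$, with $f$ regarded as a complex valued function on $[0,1]$; $f(x)^n$ denotes the $n$-th power of the value $f(x)$. *)

(* Defs.v *)
From HB Require Import structures.
From mathcomp Require Import all_boot all_order all_algebra.
From mathcomp Require Import all_classical all_reals all_analysis.
From mathcomp Require Import complex.

Set Implicit Arguments.
Unset Strict Implicit.
Unset Printing Implicit Defensive.

Import Order.TTheory GRing.Theory Num.Theory.
Import numFieldNormedType.Exports.

Local Open Scope classical_set_scope.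
Local Open Scope complex_scope.
Local Open Scope ring_scope.

(* The library integrates only real-valued functions, so the integral of a
   complex-valued function is taken componentwise.  [Rintegral] is 0 when the
   integral is undefined or infinite; the continuous integrands used below are
   integrable on [0, 1]. *)
Definition cintegral01 (R : realType) (g : R -> R[i]) : R[i] :=
  (\int[@lebesgue_measure R]_(x in `[0%R, 1%R]) complex.Re (g x))
  +i* (\int[@lebesgue_measure R]_(x in `[0%R, 1%R]) complex.Im (g x)).

Definition moment (R : realType) (f : {poly R[i]}) (n : nat) : R[i] :=
  cintegral01 (fun x : R => f.[x%:C] ^+ n).

(* Main.v *)
Require Import Defs.
From HB Require Import structures.
From mathcomp Require Import all_boot all_order all_algebra.
From mathcomp Require Import all_classical all_reals all_analysis.
From mathcomp Require Import complex.
From mathcomp Require Import ring lra.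

Set Implicit Arguments.
Unset Strict Implicit.
Unset Printing Implicit Defensive.

Import Order.TTheory GRing.Theory Num.Theory.
Import numFieldNormedType.Exports.

Local Open Scope classical_set_scope.
Local Open Scope complex_scope.
Local Open Scope ring_scope.

(** For a polynomial weight q put A_n(q) = int_0^1 q f^n, so that M_n(f) is
    A_n(1) and A_n(f q) = A_(n+1)(q).  Call a sequence superexponentially small
    when it is O(eps^n) for every eps > 0.  Both conclusions follow once
    (M_n(f))_n is shown not to be superexponentially small.  This is clear for
    a constant f; for a nonconstant f the assumption is refuted by algebra.

    There are polynomials P and v with P(0) <> 0, v(0) = v(1) = 0 and
    v f' = f P(f) (exists_euler_field).  The vector field v d/dx lifts, up to
    the factor P(s), the Euler field s d/ds along s = f(x), and it vanishes at
    the ends of [0,1].  Integrating the derivative of v q f^n therefore leaves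
    no boundary terms:
         n A_n(P(f) q) = A_n(D q),    where D q = - (v q)'.
    Let W be the set of the weights q for which (A_n(q))_n is
    superexponentially small.  It is a C[f]-submodule of C[x], stable under D,
    and f q in W implies q in W since only the tails of sequences matter.

    First, A_n vanishes on W for all large n (small_weight_eventually_zero).
    W has finitely many generators e_i over C[f].  Expanding P(f) e_i and D e_i
    on the generators in the displayed relation gives, for the vector
    a_n = (A_n(e_i))_i, an equality between n P(0) a_n and a bounded multiple of
    a_n plus O(n) times a_(n+1), ..., a_(n+J).  Hence |a_n| is at most a constant
    times |a_(n+1)| + ... + |a_(n+J)| for large n, and a sequence with this
    property that decreases faster than every exponential is zero
    (backward_recurrence_zero).

    Second, the vanishing descends: if A_m kills W for all m > n, then A_n
    kills W (weighted_moment_descent).  In that case A_n factors through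
    W / f W and the relation reads n P(0) A_n(q) = A_n(D q).  But W / f W embeds
    in C[x] / f C[x], and D acts there with eigenvalues - P(0) rho, rho > 0: near
    a root c of multiplicity m one has v = P(0) (x - c) / m + ..., so D multiplies
    (x - c)^k by - P(0) (k + 1) / m up to higher order.  As n P(0) is not of this
    form for n >= 0, A_n is zero on W.

    If (M_n(f))_n were superexponentially small, then 1 would be in W, and
    descending to n = 0 would give 0 = A_0(1) = 1. *)

(** * Weighted moments and integration by parts *)

Section PolyIntegral.
Variable C : numFieldType.
Implicit Types p q f v P : {poly C}.

(** The integral over [0,1], written on coefficients so that it makes sense over
    any field of characteristic zero. *)
Definition poly_integral01 p : C := \sum_(i < size p) p`_i / i.+1%:R.

Lemma poly_integral01_widen n p : (size p <= n)%N -> poly_integral01 p = \sum_(i < n) p`_i / i.+1%:R.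
Proof.
move=> le_pn; rewrite /poly_integral01 (big_ord_widen n (fun i => p`_i / i.+1%:R) le_pn).
rewrite big_mkcond; apply: eq_bigr => i _; case: ltnP => // le_pi.
by rewrite nth_default ?mul0r.
Qed.

Fact poly_integral01_is_linear : linear_for *%R poly_integral01.
Proof.
move=> a p q; pose n := maxn (size p) (size q).
rewrite (@poly_integral01_widen n (a *: p + q)); last first.
  by rewrite (leq_trans (size_polyD _ _))// geq_max leq_maxr andbT
             (leq_trans (size_scale_leq _ _)) ?leq_maxl.
rewrite (@poly_integral01_widen n p) ?leq_maxl// (@poly_integral01_widen n q) ?leq_maxr//.
rewrite mulr_sumr -big_split; apply: eq_bigr => i _ /=.
by rewrite coefD coefZ mulrDl mulrA.
Qed.

HB.instance Definition _ := GRing.isLinear.Build C {poly C} C *%R poly_integral01 poly_integral01_is_linear.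

Lemma poly_integral011 : poly_integral01 1 = 1.
Proof. by rewrite /poly_integral01 size_poly1 big_ord1 coef1 divr1. Qed.

Lemma poly_integral01_deriv p : poly_integral01 p^`() = p.[1] - p.[0].
Proof.
have [->|p0] := eqVneq p 0; first by rewrite linear0 linear0 !horner0 subrr.
rewrite (@poly_integral01_widen (size p).-1); last by rewrite -ltnS prednK ?size_poly_gt0// lt_size_deriv.
rewrite horner_coef0 horner_coef -(prednK (n := size p)) ?size_poly_gt0//.
rewrite big_ord_recl expr0 mulr1 [p`_0 + _]addrC addrK; apply: eq_bigr => i _.
by rewrite coef_deriv expr1n mulr1 -[X in X / _]mulr_natr mulfK// pnatr_eq0.
Qed.

Definition weighted_moment f q n : C := poly_integral01 (q * f ^+ n).

Lemma weighted_moment_comp f b q n :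
  weighted_moment f ((b \Po f) * q) n =
  \sum_(k < size b) b`_k * weighted_moment f q (n + k).
Proof.
rewrite /weighted_moment comp_polyE !mulr_suml linear_sum; apply: eq_bigr => k _.
by rewrite /= -!scalerAl linearZ /= exprD; congr (_ * poly_integral01 _); ring.
Qed.

Lemma weighted_moment_shift f q n : weighted_moment f (f * q) n = weighted_moment f q n.+1.
Proof. by rewrite /weighted_moment exprS; congr poly_integral01; ring. Qed.

(** The integral of the derivative of v q f^n vanishes because v does at both
    endpoints, and v (f^n)' = n f^n P(f). *)
Lemma weighted_moment_by_parts f v P q n : v.[0] = 0 -> v.[1] = 0 ->
  v * f^`() = f * (P \Po f) ->
  n%:R * weighted_moment f ((P \Po f) * q) n =
  weighted_moment f (- (v * q)^`()) n.
Proof.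
move=> v0 v1 vf; apply/eqP; rewrite -subr_eq0; apply/eqP.
have: poly_integral01 (v * q * f ^+ n)^`() = 0 by rewrite poly_integral01_deriv !hornerM v0 v1 !mul0r subrr.
rewrite derivM linearD /= addrC => <-.
rewrite /weighted_moment mulNr linearN /= opprK; congr (_ + _).
case: n => [|n]; first by rewrite expr0 -polyC1 derivC mulr0 linear0 mul0r.
rewrite deriv_exp mulrnAr linearMn /= -[RHS]mulr_natl; congr (_ * poly_integral01 _).
transitivity (v * f^`() * (q * f ^+ n)); last by ring.
by rewrite vf exprS; ring.
Qed.

End PolyIntegral.

(** * The vector field lifting the Euler field *)

Section EulerField.
Variable C : numClosedFieldType.
Implicit Types p q f v P : {poly C}.

(** Take for P the product of the X - f(c) over the roots c of p: after
    substitution each factor f - f(c) is divisible by X - c. *)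
Lemma exists_comp_multiple f p : p != 0 ->
  (forall c, root p c -> f.[c] != 0) ->
  exists2 P, P.[0] != 0 & p %| P \Po f.
Proof.
move=> p0 hp; have [rs Dp] := closed_field_poly_normal p.
exists (\prod_(c <- rs) ('X - f.[c]%:P)).
  rewrite horner_prod prodf_seq_neq0; apply/allP => c rc.
  rewrite /= !hornerE oppr_eq0; apply: hp.
  by rewrite Dp rootZ ?lead_coef_eq0// root_prod_XsubC.
rewrite Dp dvdpZl ?lead_coef_eq0// (rmorph_prod (comp_poly f)) /=.
elim: rs {Dp} => [|c rs IH]; first by rewrite !big_nil dvdpp.
rewrite !big_cons dvdp_mul// comp_polyB comp_polyX comp_polyC.
by rewrite dvdp_XsubCl /root !hornerE subrr.
Qed.

(** Write f = (X - c)^m g with g(c) <> 0; then f' is (X - c)^(m-1) times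
    m g + (X - c) g', and (X - c)^(m-1) cancels from v f' = f u.  What remains can
    be evaluated at c. *)
Lemma root_cofactor_eq f c : f != 0 -> root f c -> exists m g,
  [/\ (0 < m)%N, g.[c] != 0 & forall v u, v * f^`() = f * u ->
    v * (m%:R * g + ('X - c%:P) * g^`()) = ('X - c%:P) * g * u].
Proof.
move=> f0 fc; have [m [g]] := multiplicity_XsubC f c.
rewrite f0 /= => gc Df; exists m, g.
case: m Df => [|m] Df; first by move: fc; rewrite Df mulr1 (negPf gc).
split=> // v u; rewrite Df derivM deriv_exp derivXsubC mul1r /= => H.
have Xm0 : ('X - c%:P) ^+ m != 0 by rewrite expf_neq0// polyXsubC_eq0.
apply: (mulIf Xm0); move: H; rewrite -mulr_natl exprS => H.
transitivity (v * (g^`() * (('X - c%:P) * ('X - c%:P) ^+ m) + g * (m.+1%:R * ('X - c%:P) ^+ m))).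
  by ring.
by rewrite H; ring.
Qed.


(** Divide f and f' by their gcd to get a and b.  Every root of f is a root of a,
    since f' vanishes to a lower order there, so the roots of b avoid those of f
    and b divides P1(f) for some P1 with P1(0) <> 0.  Then a P1(f) / b solves the
    equation, and it already vanishes at an endpoint where f does; a second
    factor P2(f) makes it vanish at the other endpoints. *)
Lemma exists_euler_field f : (1 < size f)%N ->
  exists P v, [/\ P.[0] != 0, v * f^`() = f * (P \Po f), v.[0] = 0 & v.[1] = 0].
Proof.
move=> f1; have f0 : f != 0 by rewrite -size_poly_gt0 ltnW.
have f'0 : f^`() != 0.
  apply: contraTneq f1 => f'0; rewrite -leqNgt; apply/leq_sizeP => -[//|i] _.
  have /eqP := coef_deriv f i; rewrite f'0 coef0 eq_sym -mulr_natr mulf_eq0.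
  by rewrite pnatr_eq0 orbF => /eqP.
pose g := gcdp f f^`(); pose a := f %/ g; pose b := f^`() %/ g.
have Df : f = a * g by rewrite divpK// dvdp_gcdl.
have Db : f^`() = b * g by rewrite divpK// dvdp_gcdr.
have cab : coprimep a b by apply: coprimep_div_gcd; rewrite f0.
have b0 : b != 0 by apply: contraNneq f'0 => b0; rewrite Db b0 mul0r.
have ra c : root f c -> root a c.
  move=> fc; have [m [h [m0 hc]]] := root_cofactor_eq f0 fc.
  move=> /(_ a b); rewrite {1}Db {1}Df => /(_ ltac:(ring))/(congr1 (horner^~ c)).
  rewrite !hornerE subrr !mul0r addr0 => /eqP.
  by rewrite !mulf_eq0 (negPf hc) -polyC_natr hornerC pnatr_eq0 eqn0Ngt m0 !orbF.
have [P1 P10 bP1] : exists2 P, P.[0] != 0 & b %| P \Po f.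
  apply: exists_comp_multiple => // c bc; apply: contraTneq bc => fc.
  by apply: (coprimep_root cab); apply: ra; apply/rootP.
pose w := \prod_(c <- [seq c <- [:: 0; 1] | f.[c] != 0]) ('X - c%:P).
have [P2 P20 wP2] : exists2 P, P.[0] != 0 & w %| P \Po f.
  apply: exists_comp_multiple => [|c].
    by apply/monic_neq0/monic_prod_XsubC.
  by rewrite root_prod_XsubC mem_filter => /andP[].
exists (P1 * P2), (a * ((P1 \Po f) %/ b) * (P2 \Po f)).
have v01 c : c \in [:: 0; 1] -> (a * ((P1 \Po f) %/ b) * (P2 \Po f)).[c] = 0.
  move=> c01; apply/rootP; rewrite !rootM.
  have [/eqP/ra->//|fc] := eqVneq f.[c] 0.
  suff -> : root (P2 \Po f) c by rewrite orbT.
  apply: root_dvdp wP2 _.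
  by rewrite root_prod_XsubC mem_filter fc.
split; rewrite ?v01 ?inE ?eqxx ?orbT//; first by rewrite hornerM mulf_neq0.
rewrite comp_polyM -[in RHS](divpK bP1).
by set A := _ %/ b; set B := P2 \Po f; rewrite Db [in RHS]Df; ring.
Qed.

(** The exponent: rho is the inverse of the multiplicity of c as a root of f. *)
Lemma euler_field_root f v P c : f != 0 -> root f c ->
  v * f^`() = f * (P \Po f) -> P.[0] != 0 ->
  v.[c] = 0 /\ exists2 rho : C, 0 < rho & v^`().[c] = P.[0] * rho.
Proof.
move=> f0 fc vf P0; have [m [g [m0 gc /(_ _ _ vf) H]]] := root_cofactor_eq f0 fc.
have mc : (m%:R : {poly C}).[c] = m%:R by rewrite -polyC_natr hornerC.
have mg0 : m%:R * g.[c] != 0 by rewrite mulf_neq0// pnatr_eq0 -lt0n.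
have vc : v.[c] = 0.
  move/(congr1 (horner^~ c))/eqP: H.
  by rewrite !hornerE subrr !mul0r addr0 mc mulf_eq0 (negPf mg0) orbF => /eqP.
split=> //; exists m%:R^-1; first by rewrite invr_gt0 ltr0n.
move/(congr1 (fun p => p^`().[c])): H.
rewrite !derivM derivD derivXsubC !hornerE subrr vc !mul0r !addr0.
rewrite mc horner_comp (rootP fc) => H.
by apply: (mulIf mg0); rewrite H mulrC mulrA divfK// pnatr_eq0 eqn0Ngt m0.
Qed.

End EulerField.

(** * Descent of the vanishing *)

Section Descent.
Variables (C : numClosedFieldType) (f P v : {poly C}).
Hypotheses (f0 : f != 0) (P0 : P.[0] != 0) (vf : v * f^`() = f * (P \Po f)).

(** The polynomial h is v g'/g for g the product over s.  Each factor X - a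
    contributes v / (X - a), whose value at a root c of f is v'(c) if a = c and
    0 otherwise; this is where the nonnegative multiple of P(0) comes from. *)
Lemma euler_field_log_deriv s : all (root f) s ->
  exists2 h, v * (\prod_(a <- s) ('X - a%:P))^`() = \prod_(a <- s) ('X - a%:P) * h &
    forall c, root f c -> exists2 rho : C, 0 <= rho & h.[c] = P.[0] * rho.
Proof.
elim: s => [_|a s IH /= /andP[fa /IH[h hE hroot]]].
  exists 0; first by rewrite big_nil -polyC1 derivC !mulr0.
  by move=> c _; exists 0; rewrite // horner0 mulr0.
have [va [rho rho_gt0 v'a]] := euler_field_root f0 fa vf P0.
have /factor_theorem[w Dv] : root v a by apply/rootP.
exists (w + h).
  rewrite big_cons derivM derivXsubC mul1r mulrDr [v * (_ * _)]mulrCA hE.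
  by rewrite {1}Dv; ring.
move=> c fc; have [rho' rho'_ge0 hc] := hroot c fc.
have [ca|ca] := eqVneq c a.
  exists (rho + rho'); first by rewrite addr_ge0// ltW.
  rewrite hornerD hc mulrDr -v'a Dv derivM derivXsubC ca !hornerE subrr.
  by rewrite mulr0 add0r.
exists rho' => //; rewrite hornerD hc.
have [vc _] := euler_field_root f0 fc vf P0.
move/eqP: vc; rewrite Dv !hornerE mulf_eq0 subr_eq0 (negPf ca) orbF => /eqP->.
by rewrite add0r.
Qed.

Hypotheses (v0 : v.[0] = 0) (v1 : v.[1] = 0).
Variable W : {poly C} -> Prop.
Hypotheses (W_lin : forall a p q, W p -> W q -> W (a *: p + q))
           (W_sat : forall q, W (f * q) -> W q)
           (W_der : forall q, W q -> W (- (v * q)^`())).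

(** Put g = product of X - a over a list s of roots of f.  The functional A_n
    kills the multiples of f in W; the factors of f are removed one at a time.
    If A_n kills the multiples of (X - c) g in W, then it also kills those of g,
    because D + beta maps multiples of g to multiples of (X - c) g, with
    beta = P(0) (rho + rho') and rho > 0, rho' >= 0, whereas A_n o D = n P(0) A_n. *)
Lemma weighted_moment_descent n :
  (forall m q, (n < m)%N -> W q -> weighted_moment f q m = 0) ->
  forall q, W q -> weighted_moment f q n = 0.
Proof.
move=> Wgt.
(* Of P(f) only the constant term survives: the other ones shift n upwards. *)
have Wgt_P q : W q -> n%:R * (P.[0] * weighted_moment f q n) =
    weighted_moment f (- (v * q)^`()) n.
  move=> Wq; rewrite -(weighted_moment_by_parts q n v0 v1 vf) weighted_moment_comp.
  have P_gt0 : (0 < size P)%N.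
    by rewrite size_poly_gt0; apply: contraNneq P0 => ->; rewrite horner0.
  rewrite -(prednK P_gt0) big_ord_recl addn0 horner_coef0 big1 ?addr0// => i _.
  by rewrite Wgt ?mulr0// lift0 addnS ltnS leq_addr.
pose V s := forall q, W (\prod_(a <- s) ('X - a%:P) * q) ->
  weighted_moment f (\prod_(a <- s) ('X - a%:P) * q) n = 0.
have Vcons c s : all (root f) (c :: s) -> V (c :: s) -> V s.
  move=> /= /andP[fc /euler_field_log_deriv[h hE /(_ _ fc)[rho' rho'_ge0 hc]]].
  have [vc [rho rho_gt0 v'c]] := euler_field_root f0 fc vf P0.
  rewrite /V big_cons; move: hE; set g := \prod_(a <- s) _ => hE Vc q Wgq.
  pose beta := P.[0] * (rho + rho').
  pose u := v^`() * q + h * q + v * q^`().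
  have /factor_theorem[k Dk] : root (u - beta *: q) c.
    by apply/rootP; rewrite !hornerE v'c hc vc /beta; ring.
  have Du : - (v * (g * q))^`() = - (g * u).
    rewrite !derivM mulrDr [v * (_ * _)]mulrA hE /u; ring.
  (* The cofactor of D(g q) + beta g q is beta q - u, and u(c) = beta q(c). *)
  have Dstep : beta *: (g * q) + - (v * (g * q))^`() = ('X - c%:P) * g * (- k).
    rewrite Du (_ : u = k * ('X - c%:P) + beta *: q) ?subrK//; last by rewrite -Dk subrK.
    by rewrite -!mul_polyC; ring.
  have: weighted_moment f (beta *: (g * q) + - (v * (g * q))^`()) n = 0.
    by rewrite Dstep; apply: Vc; rewrite -Dstep; apply: W_lin (W_der _).
  rewrite /weighted_moment mulrDl linearD /= -!scalerAl linearZ /=.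
  have := Wgt_P _ Wgq; rewrite /weighted_moment => <-.
  rewrite mulrA -mulrDl => /eqP; rewrite mulf_eq0 => /orP[|/eqP//].
  rewrite /beta [n%:R * _]mulrC -mulrDr mulf_eq0 (negPf P0) /= => /eqP H.
  suff : 0 < rho + rho' + n%:R by rewrite H ltxx.
  by rewrite ltr_wpDr// ltr_wpDr.
have [rs Df] := closed_field_poly_normal f.
have Vrs : V rs.
  move=> q; have -> : \prod_(a <- rs) ('X - a%:P) * q = f * ((lead_coef f)^-1 *: q).
    by rewrite {1}Df -scalerAl -scalerAr scalerA mulfV ?lead_coef_eq0// scale1r.
  by rewrite weighted_moment_shift => /W_sat; exact: Wgt.
have {Vrs} : all (root f) rs -> V [::].
  by elim: rs Vrs {Df} => // c s IH Vcs rcs; apply: IH; [apply: Vcons Vcs | case/andP: rcs].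
move=> Vnil q Wq; have := Vnil _ q; rewrite big_nil mul1r; apply => //.
apply/allP => c; rewrite -root_prod_XsubC {1}Df.
by rewrite rootZ// lead_coef_eq0.
Qed.

End Descent.

(** * Finite generation over the subring of polynomials in f *)

Section FiniteGeneration.
Variables (F : fieldType) (f : {poly F}).

(** Submodules of F[x] over the subring F[f]. *)
Definition comp_submodule (V : {poly F} -> Prop) :=
  [/\ V 0, forall a p q, V p -> V q -> V (a *: p + q) & forall q, V q -> V (f * q)].

Lemma comp_submoduleX V k q : comp_submodule V -> V q -> V (f ^+ k * q).
Proof.
move=> [_ _ Vf] Vq; elim: k => [|k IH]; first by rewrite mul1r.
by rewrite exprS -mulrA; apply: Vf.
Qed.

Lemma comp_submoduleM V b q : comp_submodule V -> V q -> V ((b \Po f) * q).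
Proof.
move=> Vsub Vq; have [V0 Vlin _] := Vsub.
rewrite comp_polyE mulr_suml; apply: (big_ind V) => // [p r Vp Vr|k _].
  by rewrite -[p]scale1r; apply: Vlin.
by rewrite -scalerAl -[_ *: _]addr0; apply: Vlin => //; apply: comp_submoduleX.
Qed.

Lemma size_sub_lead (p q : {poly F}) : size p = size q -> q != 0 ->
  (size (q - (lead_coef q / lead_coef p) *: p)%R < size q)%N.
Proof.
move=> spq q0; have p0 : p != 0 by rewrite -size_poly_gt0 spq size_poly_gt0.
have sq : (0 < size q)%N by rewrite size_poly_gt0.
rewrite -[X in (_ < X)%N](prednK sq) ltnS; apply/leq_sizeP => j.
rewrite leq_eqVlt => /predU1P[<-|ltj].
  rewrite coefB coefZ -{2}spq -/(lead_coef q) -/(lead_coef p).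
  by rewrite divfK ?lead_coef_eq0// subrr.
by rewrite coefB coefZ !nth_default ?mulr0 ?subrr// ?spq -ltnS -(prednK sq).
Qed.

(** For each residue i modulo d = deg f choose in W a nonzero element of least
    degree among those of degree congruent to i (or 0 if there is none).  The
    leading term of any q in W is that of c f^k e_i for some i, and subtracting
    this lowers the degree.  Generation is phrased as minimality, so that
    properties of W are proved by checking them on the generators. *)
Lemma comp_submodule_fin_gen W : (1 < size f)%N -> comp_submodule W ->
  exists e : 'I_(size f).-1 -> {poly F}, (forall i, W (e i)) /\
    forall V, comp_submodule V -> (forall i, V (e i)) -> forall q, W q -> V q.
Proof.
move=> f1 Wsub; have [W0 Wlin Wf] := Wsub.
set d := (size f).-1; have d_gt0 : (0 < d)%N by rewrite /d -subn1 subn_gt0.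
pose inW i (q : {poly F}) := [/\ W q, q != 0 & ((size q).-1 %% d = i)%N].
have minW (i : 'I_d) : exists e, W e /\
    forall q, inW i q -> inW i e /\ (size e <= size q)%N.
  have [[q0 Wq0]|noq] := pselect (exists q, inW i q); last first.
    by exists 0; split=> // q Wq; case: noq; exists q.
  pose Q n := `[< exists2 q, inW i q & size q = n >].
  have exQ : exists n, Q n by exists (size q0); apply/asboolP; exists q0.
  have [n /asboolP[e We en] minn] := ex_minnP exQ.
  exists e; split=> [|q Wq]; first by case: We.
  by split=> //; rewrite en; apply: minn; apply/asboolP; exists q.
have [e He] := choice minW.
exists e; split=> [i|V [V0 Vlin Vf] Ve q]; first by case: (He i).
have Vsub : comp_submodule V by [].
have [n] := ubnP (size q); elim: n q => // n IH q /ltnSE-le_qn Wq.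
have [->//|q0] := eqVneq q 0.
pose i := Ordinal (ltn_pmod (size q).-1 d_gt0).
have [Wei /(_ q)[]//] := He i; move=> [_ e0 ei] le_eq.
pose k := (((size q).-1 - (size (e i)).-1) %/ d)%N.
have sz : size (f ^+ k * e i) = size q.
  have f0 : f != 0 by rewrite -size_poly_gt0 ltnW.
  have e_gt0 : (0 < size (e i))%N by rewrite size_poly_gt0.
  have q_gt0 : (0 < size q)%N by rewrite size_poly_gt0.
  rewrite size_mul ?expf_neq0// -(prednK e_gt0) addnS /=.
  rewrite -(prednK (n := size (f ^+ k))) ?size_poly_gt0 ?expf_neq0//.
  rewrite size_exp -/d addSn -[RHS](prednK q_gt0); congr S.
  have -> : (d * k = (size q).-1 - (size (e i)).-1)%N.
    rewrite mulnC divnK// -eqn_mod_dvd ?ei//=.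
    by rewrite -!subn1 leq_sub2r.
  by rewrite subnK// -!subn1 leq_sub2r.
have := size_sub_lead sz q0; set c := _ / _ => lt_q.
rewrite -[q](subrK (c *: (f ^+ k * e i))) addrC.
apply: Vlin; first exact: comp_submoduleX.
apply: IH; first exact: leq_trans lt_q le_qn.
by rewrite addrC -scaleNr; apply: Wlin => //; apply: comp_submoduleX.
Qed.

End FiniteGeneration.

(** * Superexponentially small sequences *)

Section Growth.
Variable R : realType.
Import ComplexField.Normc.
Implicit Types u : nat -> R[i].

Lemma normc_ge0 (x : R[i]) : 0 <= normc x.
Proof. by case: x => a b; rewrite /normc sqrtr_ge0. Qed.

Lemma normcD (x y : R[i]) : normc (x + y) <= normc x + normc y.
Proof. exact: le_normcD. Qed.

Lemma normc_nat n : normc (n%:R : R[i]) = n%:R.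
Proof.
by have := @normcMn R 1 n; rewrite normc1 => <-.
Qed.

Definition superexp_small u :=
  forall eps : R, 0 < eps -> exists K, forall n, normc (u n) <= K * eps ^+ n.

Lemma superexp_small_lin a u w : superexp_small u -> superexp_small w ->
  superexp_small (fun n => a * u n + w n).
Proof.
move=> su sw eps e0; have [K1 H1] := su _ e0; have [K2 H2] := sw _ e0.
exists (normc a * K1 + K2) => n; rewrite (le_trans (normcD _ _))// mulrDl lerD//.
by rewrite normcM -mulrA ler_wpM2l ?normc_ge0.
Qed.

(** Only the tail matters, hence the equivalence; its reverse direction is what
    makes the set of small weights saturated for multiplication by f. *)
Lemma superexp_small_shift u : superexp_small u <-> superexp_small (fun n => u n.+1).
Proof.
split=> su eps e0; have [K H] := su _ e0.
  by exists (K * eps) => n; rewrite -mulrA -exprS.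
exists (normc (u 0%N) + K / eps) => -[|n].
  rewrite expr0 mulr1 lerDl divr_ge0// ?(ltW e0)//.
  by have := H 0%N; rewrite expr0 mulr1; move=> /(le_trans (normc_ge0 _)).
rewrite mulrDl (le_trans (H n))// [in leRHS]exprS [K / eps * _]mulrA divfK ?gt_eqF// lerDr.
by rewrite !mulr_ge0 ?normc_ge0 ?exprn_ge0// ltW.
Qed.

Lemma superexp_smallMn u : superexp_small u -> superexp_small (fun n => n%:R * u n).
Proof.
move=> su eps e0; have [K H] := su (eps / 2) (divr_gt0 e0 (ltr0Sn _ _)).
have K0 : 0 <= K by have := H 0%N; rewrite expr0 mulr1; move=> /(le_trans (normc_ge0 _)).
exists K => n; rewrite normcM normc_nat.
apply: (@le_trans _ _ (2 ^+ n * (K * (eps / 2) ^+ n))).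
  apply: ler_pM; rewrite ?ler0n ?normc_ge0//.
  by rewrite -natrX ler_nat ltnW// ltn_expl.
by rewrite mulrCA -exprMn [2 * _]mulrC divfK// pnatr_eq0.
Qed.

(** With eps so small that K (eps + ... + eps^J) <= 1/2, one use of the
    recurrence improves a bound s n <= B eps^n by a factor 2; iterating, s n = 0. *)
Lemma backward_recurrence_zero (s : nat -> R) K J n0 :
  (forall n, 0 <= s n) ->
  (forall eps : R, 0 < eps -> exists B, forall n, s n <= B * eps ^+ n) ->
  0 <= K ->
  (forall n, (n0 <= n)%N -> s n <= K * \sum_(k < J) s (n + k).+1) ->
  forall n, (n0 <= n)%N -> s n = 0.
Proof.
move=> s0 ssmall K0 rec.
pose eps : R := (2 * (K * J%:R + 1))^-1.
have KJ0 : 0 <= K * J%:R by rewrite mulr_ge0// ler0n.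
have e_gt0 : 0 < eps by rewrite invr_gt0; lra.
have e_le1 : eps <= 1 by rewrite invf_le1; lra.
have e_half : K * J%:R * eps <= 2^-1.
  by rewrite /eps ler_pdivrMr; lra.
have [B HB] := ssmall _ e_gt0.
have B0 : 0 <= B by have := HB 0%N; rewrite expr0 mulr1; move=> /(le_trans (s0 _)).
have halve j : forall n, (n0 <= n)%N -> s n <= B * eps ^+ n * 2^-1 ^+ j.
  elim: j => [|j IH] n len; first by rewrite expr0 mulr1.
  apply: le_trans (rec n len) _.
  apply: (@le_trans _ _ (K * \sum_(k < J) (B * eps ^+ n * 2^-1 ^+ j * eps))).
    apply: ler_wpM2l => //; apply: ler_sum => k _.
    apply: le_trans (IH _ _) _; first by rewrite leqW// (leq_trans len)// leq_addr.
    rewrite [leRHS]mulrAC ler_wpM2r ?exprn_ge0 ?invr_ge0 ?ler0n//.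
    rewrite -mulrA ler_wpM2l// -exprSr -addSn exprD ler_piMr ?exprn_ge0 ?(ltW e_gt0)//.
    by rewrite exprn_ile1 ?(ltW e_gt0).
  rewrite sumr_const card_ord -[_ *+ J]mulr_natr.
  rewrite [leLHS](_ : _ = (B * eps ^+ n * 2^-1 ^+ j) * (K * J%:R * eps)); last by ring.
  rewrite [in leRHS]exprSr [leRHS]mulrA ler_wpM2l//.
  by rewrite !mulr_ge0 ?exprn_ge0 ?(ltW e_gt0) ?invr_ge0 ?ler0n.
move=> n len; apply/eqP; apply: contraT => sn0.
have {sn0}sn : 0 < s n by rewrite lt_def sn0 s0.
have Bn0 : 0 <= B * eps ^+ n by rewrite mulr_ge0 ?exprn_ge0 ?(ltW e_gt0).
have := archi_boundP (divr_ge0 Bn0 (ltW sn)); set N := Num.bound _.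
rewrite ltr_pdivrMr// => ltN; have := halve N n len.
rewrite exprVn ler_pdivlMr ?exprn_gt0// leNgt => /negP[].
apply: lt_le_trans ltN _; rewrite mulrC ler_wpM2l ?ltW//.
by rewrite -natrX ltr_nat ltn_expl.
Qed.

End Growth.

(** * Weights whose moments are superexponentially small *)

Section Vanishing.
Variables (R : realType) (f : {poly R[i]}).
Import ComplexField.Normc.
Implicit Types (p q v P : {poly R[i]}).

Definition small_weight q := superexp_small (weighted_moment f q).

Lemma weighted_momentP a p q n :
  weighted_moment f (a *: p + q) n = a * weighted_moment f p n + weighted_moment f q n.
Proof. by rewrite /weighted_moment mulrDl -scalerAl linearP. Qed.

Lemma weighted_moment0 n : weighted_moment f 0 n = 0.
Proof. by rewrite /weighted_moment mul0r linear0. Qed.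

Lemma normc_sum (I : Type) (r : seq I) (F : I -> R[i]) :
  normc (\sum_(i <- r) F i) <= \sum_(i <- r) normc (F i).
Proof.
elim: r => [|i r IH]; first by rewrite !big_nil normc0.
by rewrite !big_cons (le_trans (normcD _ _))// lerD2l.
Qed.

Lemma small_weight_lin a p q :
  small_weight p -> small_weight q -> small_weight (a *: p + q).
Proof.
move=> sp sq eps e0; have [K HK] := superexp_small_lin a sp sq e0.
by exists K => n; rewrite weighted_momentP.
Qed.

Lemma small_weightM q : small_weight (f * q) <-> small_weight q.
Proof.
rewrite /small_weight (superexp_small_shift (weighted_moment f q)).
by split=> H eps /H[K HK]; exists K => n; have := HK n; rewrite weighted_moment_shift.
Qed.

Lemma small_weight_submodule : comp_submodule f small_weight.
Proof.
split=> [eps _|a p q|q]; first by exists 0 => n; rewrite weighted_moment0 normc0 mul0r.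
- exact: small_weight_lin.
- by move/small_weightM.
Qed.

Lemma small_weight_der v P q : v.[0] = 0 -> v.[1] = 0 ->
  v * f^`() = f * (P \Po f) -> small_weight q -> small_weight (- (v * q)^`()).
Proof.
move=> v0 v1 vf sq eps e0.
have sPq := comp_submoduleM P small_weight_submodule sq.
have [K HK] := superexp_smallMn sPq e0.
by exists K => n; rewrite -(weighted_moment_by_parts q n v0 v1 vf).
Qed.

Section Dominated.
Variables (I : finType) (e : I -> {poly R[i]}).

Let s n := \sum_i normc (weighted_moment f (e i) n).

(** The moments against q are bounded by those against the generators e, taken
    over a window of J indices. *)
Definition dominated q := exists K : R, exists J : nat, 0 <= K /\
  forall n, normc (weighted_moment f q n) <= K * \sum_(k < J) s (n + k).

Lemma gen_size_ge0 n : 0 <= s n.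
Proof. by apply: sumr_ge0 => i _; apply: normc_ge0. Qed.

Lemma ler_window J J' n : (J <= J')%N ->
  \sum_(k < J) s (n + k) <= \sum_(k < J') s (n + k).
Proof.
move=> leJ; rewrite (big_ord_widen J' (fun k => s (n + k)) leJ) big_mkcond.
by apply: ler_sum => k _; case: ifP => // _; apply: gen_size_ge0.
Qed.

Lemma dominated_submodule : comp_submodule f dominated.
Proof.
split=> [|a p q [K1 [J1 [K10 H1]]] [K2 [J2 [K20 H2]]]|q [K [J [K0 H]]]].
- exists 0, 0%N; split=> // n; by rewrite weighted_moment0 normc0 mul0r.
- exists (normc a * K1 + K2), (maxn J1 J2); split.
    by rewrite addr_ge0// mulr_ge0// normc_ge0.
  move=> n; rewrite weighted_momentP (le_trans (normcD _ _))// normcM mulrDl -mulrA.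
  apply: lerD; first apply: ler_wpM2l; rewrite ?normc_ge0//.
    by apply: le_trans (H1 n) _; rewrite ler_wpM2l// ler_window// leq_maxl.
  by apply: le_trans (H2 n) _; rewrite ler_wpM2l// ler_window// leq_maxr.
exists K, J.+1; split=> // n; rewrite weighted_moment_shift.
apply: le_trans (H n.+1) _; rewrite ler_wpM2l// big_ord_recl addrC.
by apply: ler_wpDr (gen_size_ge0 _) _; apply: ler_sum => k _; rewrite lift0 addSnnS.
Qed.

Lemma dominated_gen i : dominated (e i).
Proof.
exists 1, 1%N; split=> // n; rewrite mul1r big_ord1 addn0 /s (bigD1 i)//= lerDl.
by apply: sumr_ge0 => j _; apply: normc_ge0.
Qed.

(** The window is allowed to grow so that estimates for different families can
    be put on a common one. *)
Lemma dominated_sum (q : I -> {poly R[i]}) : (forall i, dominated (q i)) ->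
  exists K : R, exists J : nat, 0 <= K /\ forall n J', (J <= J')%N ->
  \sum_i normc (weighted_moment f (q i) n) <= K * \sum_(k < J') s (n + k).
Proof.
move=> dq; elim: (index_enum I) => [|i r [K1 [J1 [K10 H1]]]].
  by exists 0, 0%N; split=> // n J' _; rewrite big_nil mul0r.
have [K2 [J2 [K20 H2]]] := dq i; exists (K2 + K1), (maxn J2 J1).
split=> [|n J']; first exact: addr_ge0.
rewrite geq_max => /andP[J2' J1']; rewrite big_cons mulrDl lerD// ?H1//.
by apply: le_trans (H2 n) _; rewrite ler_wpM2l// ler_window.
Qed.

End Dominated.

Lemma superexp_small_sum (I : finType) (u : I -> nat -> R[i]) :
  (forall i, superexp_small (u i)) ->
  forall eps : R, 0 < eps -> exists B, forall n,
    \sum_i normc (u i n) <= B * eps ^+ n.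
Proof.
move=> su eps e0; elim: (index_enum I) => [|i r [B1 H1]].
  by exists 0 => n; rewrite big_nil mul0r.
have [B2 H2] := su i _ e0; exists (B2 + B1) => n.
by rewrite big_cons mulrDl lerD.
Qed.

(** Write P = P(0) + X P1.  The integration by parts becomes
      n P(0) A_n(e_i) = A_n(D e_i) - n A_(n+1)(P1(f) e_i),
    and both D e_i and P1(f) e_i are small weights, hence dominated by the
    generators.  For n |P(0)| larger than twice the constant of D, the term of
    index n on the right is absorbed on the left. *)
Lemma small_weight_eventually_zero P v : (1 < size f)%N -> P.[0] != 0 ->
  v.[0] = 0 -> v.[1] = 0 -> v * f^`() = f * (P \Po f) ->
  exists n0, forall n q, (n0 <= n)%N -> small_weight q -> weighted_moment f q n = 0.
Proof.
move=> f1 P0 v0 v1 vf.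
have [e [We Wgen]] := comp_submodule_fin_gen f1 small_weight_submodule.
set s := fun n => \sum_i normc (weighted_moment f (e i) n).
have s0 n : 0 <= s n by exact: gen_size_ge0.
have dom q : small_weight q -> dominated e q.
  by apply: Wgen; [apply: dominated_submodule | apply: dominated_gen].
have [P1 DP] : exists P1, P = P1 * 'X + P.[0]%:P.
  have /factor_theorem[P1 DP] : root (P - P.[0]%:P) 0 by rewrite /root !hornerE subrr.
  by exists P1; rewrite -['X]subr0 -polyC0 -DP subrK.
have [K1 [J1 [K10 H1]]] := dominated_sum
  (fun i => dom _ (small_weight_der v0 v1 vf (We i))).
have [K2 [J2 [K20 H2]]] := dominated_sum
  (fun i => dom _ (comp_submoduleM P1 small_weight_submodule (We i))).
pose J := maxn J1 J2; set p0 := normc P.[0].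
have p0_gt0 : 0 < p0.
  by rewrite lt_def normc_ge0 andbT; apply: contra_neq P0; apply: eq0_normc.
have bound n : n%:R * p0 * s n <=
    K1 * s n + (K1 + n%:R * K2) * \sum_(k < J) s (n + k).+1.
  have -> : n%:R * p0 * s n = \sum_i normc
      (weighted_moment f (- (v * e i)^`()) n
       - n%:R * weighted_moment f ((P1 \Po f) * e i) n.+1).
    rewrite mulr_sumr; apply: eq_bigr => i _.
    rewrite -(weighted_moment_by_parts (e i) n v0 v1 vf) -weighted_moment_shift.
    have -> : (P \Po f) * e i = P.[0] *: e i + f * ((P1 \Po f) * e i).
      by rewrite {1}DP comp_polyD comp_polyM comp_polyX comp_polyC -mul_polyC; ring.
    by rewrite weighted_momentP -mulrBr addrK -(normc_nat R) -!normcM mulrA.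
  apply: (@le_trans _ _ (\sum_i normc (weighted_moment f (- (v * e i)^`()) n)
       + n%:R * \sum_i normc (weighted_moment f ((P1 \Po f) * e i) n.+1))).
    rewrite mulr_sumr -big_split; apply: ler_sum => i _ /=.
    by rewrite (le_trans (normcD _ _))// normcN normcM normc_nat.
  have B1 := H1 n J.+1 (leqW (leq_maxl J1 J2)).
  have B2 := H2 n.+1 J (leq_maxr J1 J2).
  rewrite mulrDl addrA; apply: lerD.
    apply: le_trans B1 _; rewrite big_ord_recl addn0 mulrDr lerD2l.
    by under eq_bigr do rewrite lift0 addnS.
  by rewrite -mulrA ler_wpM2l ?ler0n.
pose n0 := (Num.bound (2 * K1 / p0)).+1.
exists n0 => n q len sq.
have K12 : 0 <= 2 * (K1 + K2) / p0 by rewrite divr_ge0 ?mulr_ge0 ?addr_ge0// ltW.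
have rec m : (n0 <= m)%N -> s m <= 2 * (K1 + K2) / p0 * \sum_(k < J) s (m + k).+1.
  move=> lem; have m_gt0 : 0 < m%:R :> R by rewrite ltr0n (leq_trans _ lem).
  have m_ge1 : 1 <= m%:R :> R by rewrite ler1n (leq_trans _ lem).
  have Kp : 2 * K1 <= m%:R * p0.
    rewrite -ler_pdivrMr//; apply: ltW; apply: (lt_le_trans (archi_boundP _)).
      by rewrite divr_ge0 ?mulr_ge0// ltW.
    by rewrite ler_nat ltnW.
  have := bound m; set S := \sum_(k < J) _ => Bm.
  have S0 : 0 <= S by apply: sumr_ge0 => k _.
  have B1 : m%:R * p0 * s m <= 2 * ((K1 + m%:R * K2) * S).
    have : 2 * K1 * s m <= m%:R * p0 * s m by rewrite ler_wpM2r.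
    move: Bm; rewrite -mulrA; lra.
  (* The bound must be linear in m to match the factor m p0 on the left. *)
  have B2 : (K1 + m%:R * K2) * S <= m%:R * (K1 + K2) * S.
    by rewrite ler_wpM2r// mulrDr lerD2r ler_peMl.
  rewrite mulrAC ler_pdivlMr// -(ler_pM2l m_gt0).
  have -> : m%:R * (s m * p0) = m%:R * p0 * s m by ring.
  apply: le_trans B1 _; rewrite [leRHS](_ : _ = 2 * (m%:R * (K1 + K2) * S)); last by ring.
  by rewrite ler_wpM2l.
have ssmall : forall eps : R, 0 < eps -> exists B, forall m, s m <= B * eps ^+ m.
  by apply: superexp_small_sum => i; exact: We.
have szero m : (n0 <= m)%N -> s m = 0.
  exact: (backward_recurrence_zero s0 ssmall K12 rec).
have [K [Jq [Kq0 Hq]]] := dom q sq.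
apply: eq0_normc; apply/eqP; rewrite eq_le normc_ge0 andbT (le_trans (Hq n))//.
rewrite big1 ?mulr0// => k _; apply: szero; exact: leq_trans len (leq_addr _ _).
Qed.

Lemma one_not_small_weight : (1 < size f)%N -> ~ small_weight 1.
Proof.
move=> f1 s1; have [P [v [P0 vf v0 v1]]] := exists_euler_field f1.
have f0 : f != 0 by rewrite -size_poly_gt0 ltnW.
have [n0 zero] := small_weight_eventually_zero f1 P0 v0 v1 vf.
have all_zero k : (k <= n0)%N ->
    forall n q, (n0 - k <= n)%N -> small_weight q -> weighted_moment f q n = 0.
  elim: k => [_ n q|k IH ltk n q]; first by rewrite subn0; apply: zero.
  rewrite leq_eqVlt => /predU1P[<-|]; last first.
    rewrite -subSn// => len; apply: IH; rewrite ?(ltnW ltk)//.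
  move: q; apply: (weighted_moment_descent f0 P0 vf v0 v1).
  - exact: small_weight_lin.
  - by move=> q /small_weightM.
  - by move=> q; apply: small_weight_der vf.
  - move=> m q; rewrite -subSn// subSS; exact: IH (ltnW ltk) m q.
have /eqP := all_zero n0 (leqnn _) 0%N 1 (eq_leq (subnn n0)) s1.
by rewrite /weighted_moment expr0 mulr1 poly_integral011 oner_eq0.
Qed.

End Vanishing.

(** * From the integral to the algebra *)

Section Integral.
Variable R : realType.
Import ComplexField.Normc.

Lemma Rintegral_horner (p : {poly R}) :
  \int[@lebesgue_measure R]_(x in `[0%R, 1%R]) p.[x] = poly_integral01 p.
Proof.
pose Q : {poly R} := \poly_(i < (size p).+1) (p`_i.-1 / i%:R).
have DQ : Q^`() = p.
  apply/polyP => i; rewrite coef_deriv coef_poly ltnS; case: ltnP => lei.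
    by rewrite -[LHS]mulr_natr divfK// pnatr_eq0.
  by rewrite nth_default// mul0rn.
rewrite -{2}DQ poly_integral01_deriv /Rintegral.
rewrite (@continuous_FTC2 R _ (horner Q))//; last 3 first.
- exact/continuous_subspaceT/continuous_horner.
- split=> [x _||]; first exact: derivable_horner.
  + exact/cvg_at_right_filter/continuous_horner.
  + exact/cvg_at_left_filter/continuous_horner.
- by move=> x _; rewrite -derivE DQ.
Qed.

(** Applied to the real and imaginary parts, the two coordinates of a complex
    integral: each is additive and linear for real scalars, so it can be pushed
    into the coefficients of h. *)
Lemma Rintegral_coordinate (phi : R[i] -> R) (h : {poly R[i]}) :
  {morph phi : z w / z + w} -> phi 0 = 0 ->
  (forall z (x : R), phi (z * x%:C) = phi z * x) ->
  \int[@lebesgue_measure R]_(x in `[0%R, 1%R]) phi h.[x%:C] = phi (poly_integral01 h).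
Proof.
move=> phiD phi0 phiZ; pose p := \poly_(i < size h) phi h`_i.
rewrite (_ : (fun x : R => phi h.[x%:C]) = horner p); last first.
  apply/funext => x; rewrite horner_coef (big_morph phi phiD phi0).
  by rewrite horner_poly; apply: eq_bigr => i _; rewrite -rmorphXn phiZ.
rewrite Rintegral_horner (poly_integral01_widen (size_poly _ _)) /poly_integral01 (big_morph phi phiD phi0).
apply: eq_bigr => i _; rewrite coef_poly ltn_ord -phiZ.
by rewrite fmorphV rmorph_nat.
Qed.

Lemma cintegral01_horner (h : {poly R[i]}) :
  cintegral01 (fun x : R => h.[x%:C]) = poly_integral01 h.
Proof.
rewrite /cintegral01 (@Rintegral_coordinate (@complex.Re R))//; last 2 first.
- by move=> [a b] [c d].
- by move=> [a b] x /=; rewrite mulr0 subr0.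
rewrite (@Rintegral_coordinate (@complex.Im R))//; first by case: (poly_integral01 h).
- by move=> [a b] [c d].
- by move=> [a b] x /=; rewrite mulr0 add0r.
Qed.

Lemma momentE (f : {poly R[i]}) n : moment f n = weighted_moment f 1 n.
Proof.
rewrite /moment /weighted_moment mul1r -cintegral01_horner /cintegral01.
by congr (_ +i* _); apply: eq_Rintegral => x _; rewrite horner_exp.
Qed.

Lemma superexp_small_tail (u : nat -> R[i]) :
  (forall eps : R, 0 < eps -> \forall n \near \oo, normc (u n) <= eps ^+ n) ->
  superexp_small u.
Proof.
move=> su eps e0; have [N _ HN] := su eps e0.
exists (1 + \sum_(k < N) normc (u k) / eps ^+ k) => n.
have S0 (k : nat) : 0 <= normc (u k) / eps ^+ k by rewrite divr_ge0 ?normc_ge0// exprn_ge0// ltW.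
have en : 0 < eps ^+ n by rewrite exprn_gt0.
rewrite mulrDl mul1r; have [leN|ltN] := leqP N n.
  by apply: ler_wpDr (HN _ leN); rewrite mulr_ge0 ?sumr_ge0// ltW.
apply: ler_wpDl; first exact: ltW.
rewrite -ler_pdivrMr// (bigD1 (Ordinal ltN))//= lerDl.
by apply: sumr_ge0 => k _; apply: S0.
Qed.

(** For a constant f = c the moments are c^n, which do not decay faster than
    (|c|/2)^n. *)
Lemma moment_not_superexp_small (f : {poly R[i]}) : f != 0 -> ~ superexp_small (moment f).
Proof.
move=> f0; have -> : moment f = weighted_moment f 1 by apply/funext => n; rewrite momentE.
have [f1|] := ltnP 1 (size f); first exact: one_not_small_weight.
move=> /size1_polyC Df; set c := f`_0 in Df.
have c0 : c != 0 by move: f0; rewrite Df polyC_eq0.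
have nc : 0 < normc c.
  by rewrite lt_def normc_ge0 andbT; apply: contra_neq c0; apply: eq0_normc.
have uE n : normc (weighted_moment f 1 n) = normc c ^+ n.
  rewrite /weighted_moment Df mul1r -polyC_exp -alg_polyC linearZ /= poly_integral011 mulr1.
  by elim: n => [|n IH]; rewrite ?normc1// !exprS normcM IH.
move=> /(_ (normc c / 2)); rewrite divr_gt0// => /(_ isT)[K HK].
pose n := Num.bound `|K|.
have := HK n; rewrite uE expr_div_n mulrCA ler_pMr ?exprn_gt0//.
rewrite ler_pdivlMr ?exprn_gt0// mul1r leNgt => /negP[].
apply: le_lt_trans (ler_norm K) _; apply: lt_trans (archi_boundP (normr_ge0 _)) _.
by rewrite -natrX ltr_nat ltn_expl.
Qed.


Lemma superexp_small_limn_esup (u : nat -> R[i]) :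
  (limn_esup (fun n => (normc (u n) `^ n%:R^-1)%:E) <= 0)%E -> superexp_small u.
Proof.
move=> limsup_le0; apply: superexp_small_tail => eps e0.
have cvg0 := limn_esup_le_cvg limsup_le0 (fun n => powR_ge0 _ _).
have /fine_cvgP[_ /cvgr0_norm_lt/(_ _ e0)] := cvg0.
apply: filterS2 (nbhs_infty_gt 0) => n n0 /=.
rewrite ger0_norm ?powR_ge0// => lt_eps.
have -> : normc (u n) = (normc (u n) `^ n%:R^-1) ^+ n.
  rewrite -powR_mulrn ?powR_ge0// -powRrM mulVf ?pnatr_eq0 -?lt0n//.
  by rewrite powRr1// normc_ge0.
by rewrite lerXn2r ?nnegrE ?powR_ge0// ltW.
Qed.

Lemma superexp_small_finite_support (u : nat -> R[i]) :
  finite_set [set n | u n != 0] -> superexp_small u.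
Proof.
move=> /finite_seqP[s suppE]; apply: superexp_small_tail => eps e0.
exists (\max_(n <- s) n).+1 => // n /= ltn.
have -> : u n = 0; last by rewrite normc0 exprn_ge0// ltW.
apply/eqP; apply: contraTT ltn => un0; rewrite -leqNgt leq_bigmax_seq//.
by have : [set n | u n != 0] n by []; rewrite suppE.
Qed.

End Integral.

Theorem theorem2p1 (R : realType) (f : {poly R[i]}) (hf : f != 0) :
  (0 < limn_esup
         (fun n : nat => (ComplexField.Normc.normc (moment f n) `^ n%:R^-1)%:E))%E
  /\ infinite_set [set n : nat | moment f n != 0].
Proof.
have notsmall := moment_not_superexp_small hf.
split; last by move=> /superexp_small_finite_support.
by rewrite ltNge; apply/negP => /superexp_small_limn_esup.
Qed.
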